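(* Let $A,B:\mathcal X\rightrightarrows\mathcal X$ be maximal $\beta$-strongly monotone with $\beta\ge 0$ and $(A+B)^{-1}(0)\neq\emptyset$, let $\gamma>0$, $\theta_0:=1+\gamma\beta/2$, $\theta\in(0,2\theta_0]$, and $\tilde\theta:=\min\{\theta,\theta_0\}$. Let $\{z_k=(u_k,v_k,x_k)\}$ be generated by the relaxed Peaceman–Rachford splitting method with relaxation parameter $\theta$ from $x_0\in\mathcal X$, and for $k\ge1$ let $a_k:=\gamma^{-1}(x_{k-1}-u_k)$, $b_k:=\gamma^{-1}(2u_k-v_k-x_{k-1})$, $$\bar u_k=\frac1k\sum_{i=1}^k u_i,\quad \bar v_k=\frac1k\sum_{i=1}^k v_i,\quad \bar a_k=\frac1k\sum_{i=1}^k a_i,\quad \bar b_k=\frac1k\sum_{i=1}^k b_i,$$ $$\varepsilon_k':=\frac1k\sum_{i=1}^k\langle a_i-\beta u_i,u_i-\bar u_k\rangle_{\mathcal X},\qquad \varepsilon_k'':=\frac1k\sum_{i=1}^k\langle b_i-\beta v_i,v_i-\bar v_k\rangle_{\mathcal X}.$$ Then, for every $k\ge1$ and every $z^*=(u^*,u^*,x^* )\in(\mathcal L_{\tilde\theta}+\gamma C)^{-1}(0)$, $$\bar a_k\in A^{[\varepsilon_k']}(\bar u_k),\qquad \bar b_k\in B^{[\varepsilon_k'']}(\bar v_k),$$ $$\gamma\|\bar a_k+\bar b_k\|_{\mathcal X}=\|\bar u_k-\bar v_k\|_{\mathcal X}\le\frac{2\|x_0-x^*\|_{\mathcal X}}{k\theta},\qquad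 \varepsilon_k'+\varepsilon_k''\le\frac{3\big(1+2(1-\tilde\theta/\theta)^2\big)\|x_0-x^*\|_{\mathcal X}^2}{k\gamma\theta}.$$
   Context: $\mathcal X$ is a finite-dimensional real vector space with inner product $\langle\cdot,\cdot\rangle_{\mathcal X}$ and associated norm $\|\cdot\|_{\mathcal X}$. For $\beta\ge 0$, a set-valued operator $T:\mathcal X\rightrightarrows\mathcal X$ is $\beta$-strongly monotone if $\langle w-w',x-x'\rangle_{\mathcal X}\ge\beta\|x-x'\|_{\mathcal X}^2$ whenever $w\in T(x)$, $w'\in T(x')$ ($0$-strongly monotone means monotone); it is maximal $\beta$-strongly monotone if it is maximal monotone and $\beta$-strongly monotone. $J_T:=(I+T)^{-1}$ is the resolvent. For $\varepsilon\ge0$ the $\varepsilon$-enlargement of a monotone operator $T$ is $$T^{[\varepsilon]}(x):=\{t:\langle t-t',x-x'\rangle_{\mathcal X}\ge-\varepsilon\ \ \forall x',\ \forall t'\in T(x')\}.$$ (The scalars $\varepsilon_k',\varepsilon_k''$ are nonnegative, so the enlargements in the claim are well defined.) Relaxed Peaceman–Rachford splitting method with parameters $\theta>0$, $\gamma>0$: given $x_0\in\mathcal X$, for $k\ge1$, $$u_k:=J_{\gamma A}(x_{k-1}),\quad v_k:=J_{\gamma B}(2u_k-x_{k-1}),\quad x_k:=x_{k-1}+\theta(v_k-u_k).$$ For $\tilde\theta>0$, $\mathcal L_{\tilde\theta}:\mathcal X^3\to\mathcal X^3$ is the linear map $$\mathcal L_{\tilde\theta}(u,v,x)=\big((1-\tilde\theta)u+\tilde\theta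 v-x,\ (\tilde\theta-2)u+(1-\tilde\theta)v+x,\ u-v\big),$$ and $C:\mathcal X^3\rightrightarrows\mathcal X^3$ is $C(u,v,x)=A(u)\times B(v)\times\{0\}$. $(\mathcal L_{\tilde\theta}+\gamma C)^{-1}(0)$ is the set of $z$ with $0\in\mathcal L_{\tilde\theta}(z)+\gamma C(z)$; all its elements are of the form $(u^*,u^*,x^* )$. *)

(* Defs.v *)
From HB Require Import structures.
From mathcomp Require Import all_boot all_order all_algebra.
From mathcomp Require Import classical_sets reals.

Set Implicit Arguments.
Unset Strict Implicit.
Unset Printing Implicit Defensive.

Import Order.TTheory GRing.Theory Num.Theory.

Local Open Scope classical_set_scope.
Local Open Scope ring_scope.

(* A set-valued operator U => V is a map T : U -> set V, so that [T x w] and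
   [w \in T x] both read "w is in T(x)". *)
Section Operators.
Context {R : realType} {U V : lmodType R}.

Definition op_inv (T : U -> set V) : V -> set U := fun w => [set x | T x w].

Definition op_fun (f : U -> V) : U -> set V := fun x => [set f x].

Definition op_add (S T : U -> set V) : U -> set V :=
  fun x => [set s + t | s in S x & t in T x].

Definition op_scale (c : R) (T : U -> set V) : U -> set V :=
  fun x => [set c *: t | t in T x].

End Operators.

(* The resolvent J_T = (I + T)^-1, as a set-valued operator. *)
Definition resolvent {R : realType} {X : lmodType R} (T : X -> set X) :
  X -> set X := op_inv (op_add (op_fun idfun) T).

Section Monotone.
(* [{dot X for idfun}] is the type of symmetric positive definite bilinear
   forms on X. *)
Context {R : realType} {X : vectType R} (ip : {dot X for idfun}).

Definition ipnorm (x : X) : R := Num.sqrt (ip x x).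

Definition strongly_monotone (beta : R) (T : X -> set X) : Prop :=
  forall x x' w w', T x w -> T x' w' ->
    ip (w - w') (x - x') >= beta * ipnorm (x - x') ^+ 2.

Definition monotone (T : X -> set X) : Prop := strongly_monotone 0 T.

Definition maximal_monotone (T : X -> set X) : Prop :=
  monotone T /\
  forall S : X -> set X, monotone S -> (forall x, T x `<=` S x) -> S = T.

Definition maximal_strongly_monotone (beta : R) (T : X -> set X) : Prop :=
  maximal_monotone T /\ strongly_monotone beta T.

Definition enlargement (eps : R) (T : X -> set X) : X -> set X :=
  fun x => [set t | forall x' t', T x' t' -> ip (t - t') (x - x') >= - eps].

End Monotone.

Section PeacemanRachford.
Context {R : realType} {X : vectType R}.

(* The resolvents are single valued for maximal monotone A and B, so membership
   determines the iterates; the values [u 0] and [v 0] are irrelevant. *)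
Definition relaxed_PR (A B : X -> set X) (theta gamma : R) (x0 : X)
    (u v x : nat -> X) : Prop :=
  x 0%N = x0 /\
  forall k, (1 <= k)%N ->
    [/\ resolvent (op_scale gamma A) (x k.-1) (u k),
        resolvent (op_scale gamma B) (2 *: u k - x k.-1) (v k) &
        x k = x k.-1 + theta *: (v k - u k)].

(* Elements of X^3 are triples (u, v, x) = ((u, v), x). *)
Definition PR_L (t : R) (z : X * X * X) : X * X * X :=
  let: (u, v, x) := z in
  ((1 - t) *: u + t *: v - x, (t - 2) *: u + (1 - t) *: v + x, u - v).

Definition PR_C (A B : X -> set X) (z : X * X * X) : set (X * X * X) :=
  let: (u, v, x) := z in A u `*` B v `*` [set 0].

Definition avg {V : lmodType R} (w : nat -> V) (k : nat) : V :=
  k%:R^-1 *: \sum_(1 <= i < k.+1) w i.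

End PeacemanRachford.

(* Main.v *)
(* Monotonicity of A - beta I and B - beta I is preserved by averaging up to the
   errors eps' and eps'', which gives the enlargement inclusions. Since
   x_k - x_(k-1) = theta (v_k - u_k), the gap between the averages is
   (x_0 - x_k) / (k theta), and Fejer monotonicity of (x_k) with respect to x*
   bounds it.

   For the errors, put xt_k := x_(k-1) + ttheta (v_k - u_k). As ttheta <= theta0,
   the map L_ttheta + gamma beta (I, I, 0) is monotone, so
   k gamma (eps' + eps'') <= sum_i <xt_i - xm, u_i - v_i>, where xm is the
   average of the xt_i. As theta <= 2 ttheta, this extragradient-like sum
   telescopes and is at most |x_0 - xm|^2 / (2 theta). Finally xt_i is a convex
   combination of x_(i-1) and x_i, so xm stays in the ball of radius
   |x_0 - x*| around x*, whence |x_0 - xm| <= 2 |x_0 - x*|. *)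
Require Import Defs.
From mathcomp Require Import all_boot all_order all_algebra.
From mathcomp Require Import classical_sets reals.
From mathcomp Require Import ring lra.

Set Implicit Arguments.
Unset Strict Implicit.
Unset Printing Implicit Defensive.

Import Order.TTheory GRing.Theory Num.Theory.

Local Open Scope classical_set_scope.
Local Open Scope ring_scope.

(** * Inner product calculus and convexity of the squared norm *)

Section InnerProduct.
Context {R : realType} {X : vectType R} (ip : {dot X for idfun}).
Implicit Types (x y z c : X) (r D : R).

Lemma ipC x y : ip x y = ip y x.
Proof. by rewrite hermC expr0 mul1r. Qed.

Lemma ip_gt0 x : x != 0 -> 0 < ip x x.
Proof. exact: neq0_dnorm_gt0. Qed.

Lemma ipDl x y z : ip (x + y) z = ip x z + ip y z.
Proof. exact: linearDl. Qed.

Lemma ipNl x z : ip (- x) z = - ip x z.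
Proof. exact: linearNl. Qed.

Lemma ipZl r x z : ip (r *: x) z = r * ip x z.
Proof. exact: linearZl_LR. Qed.

Lemma ipDr x y z : ip z (x + y) = ip z x + ip z y.
Proof. exact: linearDr. Qed.

Lemma ipNr x z : ip z (- x) = - ip z x.
Proof. exact: linearNr. Qed.

Lemma ipZr r x z : ip z (r *: x) = r * ip z x.
Proof. exact: linearZr_LR. Qed.

Definition ipE := (ipDl, ipDr, ipNl, ipNr, ipZl, ipZr).

Lemma ip0l z : ip 0 z = 0.
Proof. exact: linear0l. Qed.

Lemma ip_ge0 x : 0 <= ip x x.
Proof.
by have [->|/ip_gt0/ltW//] := eqVneq x 0; rewrite ip0l.
Qed.

Lemma sqr_ipnorm x : ipnorm ip x ^+ 2 = ip x x.
Proof. exact/sqr_sqrtr/ip_ge0. Qed.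

Lemma ipnormZ r x : ipnorm ip (r *: x) = `|r| * ipnorm ip x.
Proof.
by rewrite /ipnorm !ipE mulrA -expr2 sqrtrM ?sqr_ge0// sqrtr_sqr.
Qed.

(* Turns identities in X into identities in R, where [ring] applies. *)
Lemma ip_inj x y : (forall z, ip x z = ip y z) -> x = y.
Proof.
move=> xy; apply/eqP; rewrite -subr_eq0; apply/negPn/negP => /ip_gt0.
by rewrite ipDl ipNl xy subrr ltxx.
Qed.

(** With p = x - c and q = y - c, the slack in convexity of the squared norm is exactly r (1 - r) |p
    - q|^2. *)
Lemma ip_le_convex r x y c D : 0 <= r <= 1 ->
  ip (x - c) (x - c) <= D -> ip (y - c) (y - c) <= D ->
  ip ((1 - r) *: x + r *: y - c) ((1 - r) *: x + r *: y - c) <= D.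
Proof.
move=> /andP[r0 r1] xD yD.
have -> : (1 - r) *: x + r *: y - c = (1 - r) *: (x - c) + r *: (y - c).
  by apply: ip_inj => z; rewrite !ipE; ring.
move: (x - c) (y - c) xD yD => p q pD qD.
have := ip_ge0 (p - q); rewrite !ipE (ipC q p) => pq.
have := mulr_ge0 (mulr_ge0 r0 (_ : 0 <= 1 - r)) pq; rewrite subr_ge0 => /(_ r1).
have := ler_wpM2l r0 qD; have := ler_wpM2l (_ : 0 <= 1 - r) pD.
rewrite subr_ge0 => /(_ r1); lra.
Qed.

(** Parallelogram law: |p - q|^2 <= 2 |p|^2 + 2 |q|^2. *)
Lemma ip_subl_le4 x y c D :
  ip (x - c) (x - c) <= D -> ip (y - c) (y - c) <= D ->
  ip (x - y) (x - y) <= 4 * D.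
Proof.
have -> : x - y = (x - c) - (y - c) by apply: ip_inj => z; rewrite !ipE; ring.
move: (x - c) (y - c) => p q; have := ip_ge0 (p + q).
rewrite !ipE (ipC q p); lra.
Qed.

End InnerProduct.

(** * Averages of sequences and of points of a monotone graph *)

Section Averages.
Context {R : realType} {X : vectType R} (ip : {dot X for idfun}).
Implicit Types (w y : nat -> X) (c : X) (r : R).

Lemma avgD w y k : avg (fun i => w i + y i) k = avg w k + avg y k.
Proof. by rewrite /avg big_split scalerDr. Qed.

Lemma avgZ r w k : avg (fun i => r *: w i) k = r *: avg w k.
Proof. by rewrite /avg -scaler_sumr !scalerA mulrC. Qed.

Lemma avgB w y k : avg (fun i => w i - y i) k = avg w k - avg y k.
Proof. by rewrite /avg sumrB scalerBr. Qed.

Variable k : nat.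
Hypothesis k_gt0 : (0 < k)%N.

Let k_gt0R : 0 < k%:R :> R. Proof. by rewrite ltr0n. Qed.

Let sum_cst (V : zmodType) (c : V) : \sum_(1 <= i < k.+1) c = c *+ k.
Proof. by rewrite sumr_const_nat subn1. Qed.

Lemma sum_avg w : \sum_(1 <= i < k.+1) w i = k%:R *: avg w k.
Proof. by rewrite /avg scalerA divff ?scale1r// gt_eqF. Qed.

Lemma sum_ipl w c : \sum_(1 <= i < k.+1) ip (w i) c = k%:R * ip (avg w k) c.
Proof. by rewrite -ipZl -sum_avg linear_sumlz. Qed.

Lemma sum_ip_dev w c : \sum_(1 <= i < k.+1) ip c (w i - avg w k) = 0.
Proof.
rewrite (eq_bigr (fun i => ip (w i - avg w k) c)) => [|i _]; last exact: ipC.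
rewrite (eq_bigr (fun i => ip (w i) c - ip (avg w k) c)); last first.
  by move=> i _; rewrite !ipE.
by rewrite sumrB sum_ipl sum_cst mulr_natl subrr.
Qed.

(** Deviations from the mean sum to zero, so the first argument can be recentred freely. *)
Lemma sum_ip_subl w y c :
  \sum_(1 <= i < k.+1) ip (w i - c) (y i - avg y k) =
  \sum_(1 <= i < k.+1) ip (w i) (y i - avg y k).
Proof.
under eq_bigr do rewrite ipDl ipNl.
by rewrite sumrB sum_ip_dev subr0.
Qed.

Lemma ip_le_avg w c D :
  (forall i, (1 <= i <= k)%N -> ip (w i - c) (w i - c) <= D) ->
  ip (avg w k - c) (avg w k - c) <= D.
Proof.
move=> wD; rewrite -(ler_pM2l k_gt0R).
have : \sum_(1 <= i < k.+1) ip (w i - c) (w i - c) <= k%:R * D.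
  by rewrite mulr_natl -sum_cst ler_sum_nat.
apply: le_trans.
(* Jensen by tangents: the right-hand summands linearize |. - c|^2 at the average, and their linear
   parts cancel in the sum. *)
have -> : k%:R * ip (avg w k - c) (avg w k - c) =
  \sum_(1 <= i < k.+1) (ip (avg w k - c) (avg w k - c) +
    ip (2 *: (avg w k - c)) (w i - avg w k)).
  by rewrite big_split/= sum_ip_dev addr0 sum_cst mulr_natl.
apply: ler_sum_nat => i _.
have := ip_ge0 ip (w i - avg w k); move: (avg w k) => m.
rewrite !ipE (ipC ip m (w i)) (ipC ip c (w i)) (ipC ip c m); lra.
Qed.

(** Transportation formula: sum the hypotheses and split y_i - y' as (y_i - avg y) + (avg y -
    y'). *)
Lemma monotone_avg w y (w' y' : X) :
  (forall i, (1 <= i <= k)%N -> 0 <= ip (w i - w') (y i - y')) ->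
  - (k%:R^-1 * \sum_(1 <= i < k.+1) ip (w i) (y i - avg y k)) <=
  ip (avg w k - w') (avg y k - y').
Proof.
move=> mon; rewrite lerNl -(ler_pM2l k_gt0R) mulVKf ?gt_eqF//.
rewrite -subr_ge0 mulrN opprK -(sum_ip_subl w y w').
have -> : avg w k - w' = avg (fun i => w i - w') k.
  by rewrite avgB {3}/avg sum_cst -scaler_nat scalerA mulVf ?scale1r// gt_eqF.
rewrite -sum_ipl -big_split big_nat sumr_ge0// => i /mon.
by congr (0 <= _); rewrite /= -ipDr addrA subrK.
Qed.

(** Taking (w', y') = (w_j, y_j) in [monotone_avg] and summing over j bounds -k S by the centred
    sum, which is k S itself. *)
Lemma monotone_avg_ge0 w y :
  (forall i j, (1 <= i <= k)%N -> (1 <= j <= k)%N ->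
    0 <= ip (w i - w j) (y i - y j)) ->
  0 <= k%:R^-1 * \sum_(1 <= i < k.+1) ip (w i) (y i - avg y k).
Proof.
move=> mon; set S := _ * _.
have : k%:R * - S <= k%:R * S.
  rewrite {2}/S mulVKf ?gt_eqF// -(sum_ip_subl w y (avg w k)).
  rewrite mulr_natl -sum_cst; apply: ler_sum_nat => j jk.
  have -> : ip (w j - avg w k) (y j - avg y k) =
            ip (avg w k - w j) (avg y k - y j).
    by rewrite -opprB ipNl -ipNr opprB.
  by apply: monotone_avg => i ik; exact: mon.
rewrite ler_pM2l//; lra.
Qed.

Section StronglyMonotone.
Variables (beta : R) (T : X -> set X) (w y : nat -> X).
Hypothesis Tmon : strongly_monotone ip beta T.
Hypothesis Tw : forall i, (1 <= i <= k)%N -> T (y i) (w i).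

Let eps := k%:R^-1 *
  \sum_(1 <= i < k.+1) ip (w i - beta *: y i) (y i - avg y k).

Let shifted_mon x x' t t' : T x t -> T x' t' ->
  0 <= ip (t - beta *: x - (t' - beta *: x')) (x - x').
Proof. by move=> /Tmon/[apply]; rewrite sqr_ipnorm !ipE; lra. Qed.

Lemma strongly_monotone_avg_ge0 : 0 <= eps.
Proof. by apply: monotone_avg_ge0 => i j ik jk; exact: shifted_mon (Tw _) (Tw _). Qed.

Lemma strongly_monotone_avg_enlargement : 0 <= beta ->
  enlargement ip eps T (avg y k) (avg w k).
Proof.
move=> beta0 x' t' Tt'.
have /monotone_avg : forall i, (1 <= i <= k)%N ->
    0 <= ip (w i - beta *: y i - (t' - beta *: x')) (y i - x').
  by move=> i ik; exact: shifted_mon (Tw _) Tt'.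
rewrite -/eps avgB avgZ => /le_trans; apply.
(* Returning from T - beta I to T only adds beta |avg y - x'|^2. *)
have := mulr_ge0 beta0 (ip_ge0 ip (avg y k - x')).
by move: (avg y k) (avg w k) => ym wm; rewrite !ipE; lra.
Qed.

End StronglyMonotone.

End Averages.

(** * Inequalities for a single iteration *)

Section OneStep.
Context {R : realType} {X : vectType R} (ip : {dot X for idfun}).
Implicit Types (s t theta : R) (c d p q w x : X).

(** Used with s = gamma beta, d = x_(k-1) - x*, p = u_k - u*, q = v_k - u*. The squared distance
    changes by at most theta (theta - 2 - s) |q - p|^2 <= 0. *)
Lemma fejer_step s theta d p q : 0 <= s -> 0 <= theta <= 2 + s ->
  s * ip p p <= ip (d - p) p -> s * ip q q <= ip (2 *: p - q - d) q ->
  ip (d + theta *: (q - p)) (d + theta *: (q - p)) <= ip d d.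
Proof.
move=> s0 /andP[t0 t2] Hp Hq.
(* Sum of [Hp] and [Hq], with |p|^2 + |q|^2 >= |q - p|^2 / 2. *)
have Hd : (1 + s / 2) * ip (q - p) (q - p) <= - ip d (q - p).
  have := mulr_ge0 s0 (ip_ge0 ip (p + q)).
  move: Hp Hq; rewrite !ipE (ipC ip q p); lra.
have -> : ip (d + theta *: (q - p)) (d + theta *: (q - p)) =
    ip d d + theta * (2 * ip d (q - p) + theta * ip (q - p) (q - p)).
  by rewrite ipDl !(ipDr _ _ (theta *: _)) !ipZl !ipZr (ipC ip (q - p) d); ring.
rewrite gerDl mulr_ge0_le0//.
have := ler_wpM2r (ip_ge0 ip (q - p)) t2; lra.
Qed.

(* The left-hand side is <- L_t z - s (p, q, 0), z> for z = (p, q, w), up to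
   the third component. *)
Lemma PR_L_step s t p q w : 0 <= s -> t <= 1 + s / 2 ->
  ip (w - (1 - t) *: p - t *: q - s *: p) p +
  ip ((2 - t) *: p - (1 - t) *: q - w - s *: q) q <= ip w (p - q).
Proof.
move=> s0 ts.
have := mulr_ge0 s0 (ip_ge0 ip (p + q)).
have := mulr_ge0 (_ : 0 <= 1 + s / 2 - t) (ip_ge0 ip (p - q)).
rewrite subr_ge0 => /(_ ts); rewrite !ipE (ipC ip q p); lra.
Qed.

(** The two sides differ by theta (2 t - theta) |d|^2, whatever the reference point c. *)
Lemma extragradient_step theta t x c d : 0 <= theta <= 2 * t ->
  2 * theta * ip (x + t *: d - c) (- d) <=
  ip (x - c) (x - c) - ip (x + theta *: d - c) (x + theta *: d - c).
Proof.
move=> /andP[theta0 thetat].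
have := mulr_ge0 (mulr_ge0 theta0 (_ : 0 <= 2 * t - theta)) (ip_ge0 ip d).
rewrite subr_ge0 => /(_ thetat).
rewrite !ipE (ipC ip d x) (ipC ip c x) (ipC ip d c); lra.
Qed.

End OneStep.

(** * Operator inclusions encoded by resolvents and zeros *)

Lemma resolvent_scaleP {R : realType} {X : vectType R} (T : X -> set X)
    (gamma : R) (x y : X) : gamma != 0 ->
  resolvent (op_scale gamma T) x y -> T y (gamma^-1 *: (x - y)).
Proof.
move=> gamma0 [_ ->] [_ [t Tt <-] <-].
by rewrite addrC addKr scalerK.
Qed.

(** On triples (u, u, x) the parameter t cancels: the first two components of [PR_L] are u - x and x
    - u. *)
Lemma PR_zeroP {R : realType} {X : vectType R} (A B : X -> set X)
    (t gamma : R) (u x : X) : gamma != 0 ->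
  op_inv (op_add (op_fun (PR_L t)) (op_scale gamma (PR_C A B))) 0 (u, u, x) ->
  A u (gamma^-1 *: (x - u)) /\ B u (gamma^-1 *: (u - x)).
Proof.
move=> gamma0 [_ ->] [_ [[[a b] o] [[/= Aa Bb] _] <-]] [] + + _.
have -> : (1 - t) *: u + t *: u - x = u - x.
  by rewrite -scalerDl subrK scale1r.
have -> : (t - 2) *: u + (1 - t) *: u + x = - (u - x).
  by rewrite -scalerDl opprB [x - u]addrC -scaleN1r; congr (_ *: _ + _); ring.
move=> /addr0_eq + /addr0_eq; rewrite opprK opprB => -> ->.
by rewrite !scalerK.
Qed.

(** * Estimates along the relaxed Peaceman-Rachford iterates *)

Section Convergence.
Context {R : realType} {X : vectType R} (ip : {dot X for idfun}).
Variables (A B : X -> set X) (beta gamma theta t : R) (u v x : nat -> X).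
Hypotheses (beta_ge0 : 0 <= beta) (gamma_gt0 : 0 < gamma).
Hypothesis theta_gt0 : 0 < theta.
Hypotheses (t_gt0 : 0 < t) (t_le_theta : t <= theta).
Hypotheses (theta_le : theta <= 2 * t) (t_le : t <= 1 + gamma * beta / 2).
Hypothesis Amon : strongly_monotone ip beta A.
Hypothesis Bmon : strongly_monotone ip beta B.
Hypothesis PR : relaxed_PR A B theta gamma (x 0%N) u v x.

Let a i := gamma^-1 *: (x i.-1 - u i).
Let b i := gamma^-1 *: (2 *: u i - v i - x i.-1).

Let gamma_neq0 : gamma != 0. Proof. by rewrite gt_eqF. Qed.

Lemma PR_A i : (1 <= i)%N -> A (u i) (a i).
Proof. by move=> /PR.2[/(resolvent_scaleP gamma_neq0)]. Qed.

Lemma PR_B i : (1 <= i)%N -> B (v i) (b i).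
Proof.
by move=> /PR.2[_ /(resolvent_scaleP gamma_neq0)]; rewrite /b addrAC.
Qed.

Lemma PR_x i : (1 <= i)%N -> x i = x i.-1 + theta *: (v i - u i).
Proof. by move=> /PR.2[]. Qed.

Lemma PR_residual k : avg a k + avg b k = gamma^-1 *: (avg u k - avg v k).
Proof.
rewrite -avgD -avgB -avgZ; congr (_ *: _); apply: eq_bigr => i _.
by apply: (ip_inj (ip := ip)) => z; rewrite /a /b !ipE; ring.
Qed.

Lemma PR_gap k : (0 < k)%N ->
  (k%:R * theta) *: (avg u k - avg v k) = x 0%N - x k.
Proof.
move=> k0; rewrite mulrC -scalerA -avgB -sum_avg// scaler_sumr.
rewrite -opprB -telescope_sumr// -sumrN big_add1/=; apply: eq_bigr => i _.
by rewrite (@PR_x i.+1)//= [x i + _]addrC addrK -scalerN opprB.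
Qed.

Variables us xs : X.
Hypothesis zero : op_inv (op_add (op_fun (PR_L t)) (op_scale gamma (PR_C A B)))
    0 (us, us, xs).

Let D := ip (x 0%N - xs) (x 0%N - xs).

Lemma PR_fejer i : ip (x i - xs) (x i - xs) <= D.
Proof.
elim: i => [//|i]; apply: le_trans.
have [As Bs] := PR_zeroP gamma_neq0 zero.
have i1 : (1 <= i.+1)%N by [].
rewrite (PR_x i1)/=.
have scale c z : beta * ipnorm ip z ^+ 2 <= ip (gamma^-1 *: c) z ->
    (gamma * beta) * ip z z <= ip c z.
  rewrite sqr_ipnorm -(ler_pM2l gamma_gt0) !ipE mulVKf// mulrA//.
have -> : x i + theta *: (v i.+1 - u i.+1) - xs =
    (x i - xs) + theta *: ((v i.+1 - us) - (u i.+1 - us)).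
  by apply: (ip_inj (ip := ip)) => z; rewrite !ipE; ring.
apply: (@fejer_step _ _ _ (gamma * beta)).
- exact: mulr_ge0 (ltW _) _.
(* Here theta <= 2 t <= 2 + gamma beta. *)
- by move: theta_gt0 theta_le t_le; lra.
- apply: scale; have := Amon (PR_A i1) As.
  by rewrite -scalerBr; congr (_ <= ip (_ *: _) _);
    apply: (ip_inj (ip := ip)) => z; rewrite !ipE; ring.
- apply: scale; have := Bmon (PR_B i1) Bs.
  by rewrite -scalerBr; congr (_ <= ip (_ *: _) _);
    apply: (ip_inj (ip := ip)) => z; rewrite !ipE; ring.
Qed.

Let xt i := x i.-1 + t *: (v i - u i).

Lemma PR_xt_le i : (1 <= i)%N -> ip (xt i - xs) (xt i - xs) <= D.
Proof.
move=> i1.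
have -> : xt i = (1 - t / theta) *: x i.-1 + (t / theta) *: x i.
  rewrite (PR_x i1) scalerDr scalerA mulfVK ?gt_eqF// addrA -scalerDl.
  by rewrite subrK scale1r.
apply: ip_le_convex; [|exact: PR_fejer..].
by rewrite ltW ?divr_gt0//= ler_pdivrMr// mul1r.
Qed.

Variable k : nat.
Hypothesis k_gt0 : (0 < k)%N.

Let sumA := \sum_(1 <= i < k.+1) ip (a i - beta *: u i) (u i - avg u k).
Let sumB := \sum_(1 <= i < k.+1) ip (b i - beta *: v i) (v i - avg v k).

Lemma PR_sum_le : gamma * (sumA + sumB) <=
  \sum_(1 <= i < k.+1) ip (xt i - avg xt k) (u i - v i).
Proof.
have s0 : 0 <= gamma * beta by rewrite mulr_ge0// ltW.
set xm := avg xt k; set um := avg u k; set vm := avg v k.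
(* Since x_(i-1) = xt_i - t (v_i - u_i), these are the averages of gamma (a_i - beta u_i) and gamma
   (b_i - beta v_i). Subtracting them puts every summand in the form of [PR_L_step] with centred
   arguments. *)
pose cA := xm - (1 - t) *: um - t *: vm - (gamma * beta) *: um.
pose cB := (2 - t) *: um - (1 - t) *: vm - xm - (gamma * beta) *: vm.
have -> : \sum_(1 <= i < k.+1) ip (xt i - xm) (u i - v i) =
    \sum_(1 <= i < k.+1) ip (xt i - xm) ((u i - um) - (v i - vm)).
  under eq_bigr do rewrite ipC.
  rewrite -(sum_ip_subl _ k_gt0 _ _ (um - vm)); apply: eq_bigr => i _.
  by rewrite ipC; congr (ip _ _); rewrite !opprD !opprK addrACA.
rewrite mulrDr !mulr_sumr.
under eq_bigr do rewrite -ipZl.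
rewrite -(sum_ip_subl ip k_gt0 (fun i => gamma *: (a i - beta *: u i)) u cA).
under [X in _ + X <= _]eq_bigr do rewrite -ipZl.
rewrite -(sum_ip_subl ip k_gt0 (fun i => gamma *: (b i - beta *: v i)) v cB).
rewrite -big_split; apply: ler_sum => i _; rewrite -/um -/vm/=.
apply: le_trans (PR_L_step ip (u i - um) (v i - vm) (xt i - xm) s0 t_le).
rewrite le_eqVlt; apply/orP; left; apply/eqP.
rewrite /cA /cB /a /b /xt; move: xm um vm {cA cB} => xm um vm.
by congr (ip _ _ + ip _ _); apply: (ip_inj (ip := ip)) => z; rewrite !ipE; field.
Qed.

Lemma PR_sum_le_dist : gamma * theta * (sumA + sumB) <= 2 * D.
Proof.
set xm := avg xt k.
have /le_trans : gamma * theta * (sumA + sumB) <=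
    theta * \sum_(1 <= i < k.+1) ip (xt i - xm) (u i - v i).
  by rewrite [gamma * _]mulrC -mulrA ler_pM2l// PR_sum_le.
(* Doubling matches the factor 2 theta of [extragradient_step]; the target becomes 4 D, the bound on
   |x_0 - xm|^2. *)
apply; rewrite -(ler_pM2l (@ltr0Sn _ 1)) [leLHS]mulrA mulr_sumr.
have xm_le : ip (xm - xs) (xm - xs) <= D.
  by apply: ip_le_avg => // i /andP[i1 _]; exact: PR_xt_le.
have x0_le := ip_subl_le4 (lexx D) xm_le.
(* [extragradient_step] with c = xm and d = v_i - u_i, telescoped over i. *)
have : \sum_(1 <= i < k.+1) 2 * theta * ip (xt i - xm) (u i - v i) <=
    ip (x 0%N - xm) (x 0%N - xm) - ip (x k - xm) (x k - xm).
  rewrite -[leRHS]opprB -(telescope_sumr (fun i => ip (x i - xm) (x i - xm)))//.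
  rewrite -sumrN big_add1/=; apply: ler_sum => i _.
  rewrite opprB (@PR_x i.+1)// -[u _ - _]opprB.
  by apply: extragradient_step; rewrite ltW.
have := ip_ge0 ip (x k - xm); move: x0_le; lra.
Qed.

End Convergence.

(** * Ergodic inclusions and rates *)

Theorem theorem4p8 (R : realType) (X : vectType R) (ip : {dot X for idfun})
    (A B : X -> set X) (beta gamma theta : R) (x0 : X) (u v x : nat -> X) :
  let theta0 := 1 + gamma * beta / 2 in
  let ttheta := Num.min theta theta0 in
  0 <= beta ->
  maximal_strongly_monotone ip beta A ->
  maximal_strongly_monotone ip beta B ->
  op_inv (op_add A B) 0 !=set0 ->
  0 < gamma ->
  0 < theta -> theta <= 2 * theta0 ->
  relaxed_PR A B theta gamma x0 u v x ->
  let a := fun k => gamma^-1 *: (x k.-1 - u k) in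
  let b := fun k => gamma^-1 *: (2 *: u k - v k - x k.-1) in
  forall k : nat, (1 <= k)%N ->
  let ubar := avg u k in
  let vbar := avg v k in
  let abar := avg a k in
  let bbar := avg b k in
  let eps' := k%:R^-1 *
    \sum_(1 <= i < k.+1) ip (a i - beta *: u i) (u i - ubar) in
  let eps'' := k%:R^-1 *
    \sum_(1 <= i < k.+1) ip (b i - beta *: v i) (v i - vbar) in
  forall ustar xstar : X,
  op_inv (op_add (op_fun (PR_L ttheta)) (op_scale gamma (PR_C A B)))
    0 (ustar, ustar, xstar) ->
  [/\ 0 <= eps' /\ 0 <= eps'',
      enlargement ip eps' A ubar abar,
      enlargement ip eps'' B vbar bbar,
      gamma * ipnorm ip (abar + bbar) = ipnorm ip (ubar - vbar) /\
      ipnorm ip (ubar - vbar)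
        <= 2 * ipnorm ip (x0 - xstar) / (k%:R * theta) &
      eps' + eps'' <=
        3 * (1 + 2 * (1 - ttheta / theta) ^+ 2) * ipnorm ip (x0 - xstar) ^+ 2
          / (k%:R * gamma * theta)].
Proof.
move=> theta0 ttheta beta0 [_ Amon] [_ Bmon] _ gamma0 theta_gt0 theta_le.
move=> PR a b k k_gt0 ubar vbar abar bbar eps' eps'' us xs zero.
have x0E := PR.1; subst x0.
have theta0_gt0 : 0 < theta0 by rewrite ltr_pwDl// divr_ge0// mulr_ge0// ltW.
have t_gt0 : 0 < ttheta by rewrite lt_min theta_gt0.
have t_le_theta : ttheta <= theta by rewrite ge_min lexx.
have t_le : ttheta <= theta0 by rewrite ge_min lexx orbT.
have theta_le2t : theta <= 2 * ttheta.
  by rewrite /ttheta; case: (lerP theta theta0) => _ //; rewrite ler_peMl ?ltW// ltr1n.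
have kR_gt0 : 0 < k%:R :> R by rewrite ltr0n.
have Aa i : (1 <= i <= k)%N -> A (u i) (a i).
  by move=> /andP[i1 _]; exact: PR_A PR _ i1.
have Bb i : (1 <= i <= k)%N -> B (v i) (b i).
  by move=> /andP[i1 _]; exact: PR_B PR _ i1.
split.
- by split; [exact: (strongly_monotone_avg_ge0 _ Amon)
            |exact: (strongly_monotone_avg_ge0 _ Bmon)].
- exact: strongly_monotone_avg_enlargement.
- exact: strongly_monotone_avg_enlargement.
- split.
    rewrite /abar /bbar (PR_residual ip) ipnormZ ger0_norm ?invr_ge0 ?ltW//.
    by rewrite mulVKf ?gt_eqF.
  (* Scaled by k theta, the gap is |x_0 - x_k|; both points lie in the ball of radius |x_0 - x*|
     around x*, hence the factor 2. *)
  rewrite ler_pdivlMr ?mulr_gt0// mulrC -[X in X * _]gtr0_norm ?mulr_gt0//.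
  rewrite -ipnormZ (PR_gap PR k_gt0) -ler_sqr ?nnegrE ?mulr_ge0 ?sqrtr_ge0//.
  rewrite exprMn !sqr_ipnorm -natrX.
  apply: ip_subl_le4 (lexx _) _.
  exact: (PR_fejer beta0 gamma0 theta_gt0 theta_le2t t_le Amon Bmon PR zero).
have gap := PR_sum_le_dist beta0 gamma0 theta_gt0 t_gt0 t_le_theta theta_le2t
  t_le Amon Bmon PR zero k_gt0.
rewrite -mulrDr ler_pdivlMr ?mulr_gt0// sqr_ipnorm.
rewrite -[k%:R * _ * _]mulrA mulrACA mulVf ?gt_eqF// mul1r mulrC.
apply: le_trans gap _; rewrite ler_wpM2r ?ip_ge0//.
(* The constant 2 from [PR_sum_le_dist] is below 3, and the claimed factor is at least 3. *)
have := sqr_ge0 (1 - ttheta / theta); lra.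
Qed.
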